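(* Let $G=(V,E)$ be a finite simple graph with $V=\{v_1,\dots,v_n\}$, and let $p:V\to\mathbb{R}^3$ be such that $p$, regarded as a point of $\mathbb{R}^{3n}$, is generic. Let $S$ be either the family of concentric cylinders $\mathcal{Y}^p$ induced by $p$ or the family of concentric ellipsoids $\mathcal{E}^p$ induced by $p$. Let $(\omega,\lambda)$ be an equilibrium stress for $(G,p)$ on $S$ and let $(G,q)$ be a framework on $S$ which is equivalent to $(G,p)$. Then $(\omega,\lambda)$ is an equilibrium stress for $(G,q)$ on $S$. Furthermore, if $\operatorname{rank}\Omega_S(\omega,\lambda)=3n-\mu$, where $\mu=6$ if $S=\mathcal{Y}^p$ and $\mu=3$ if $S=\mathcal{E}^p$, then $(G,p)$ is globally rigid on $S$.
   Context: A point of $\mathbb{R}^{3n}$ is generic if its $3n$ coordinates are algebraically independent over $\mathbb{Q}$. Fix $\alpha,\beta\in\mathbb{Q}$ with $1<\alpha<\beta$. Write $p(v_i)=(x_i,y_i,z_i)$. Surfaces. For positive reals $r_1,\dots,r_n$ (not necessarily distinct), a family of concentric cylinders $\mathcal{Y}=\bigcup_i\mathcal{Y}_i$ has $\mathcal{Y}_i=\{(x,y,z)\in\mathbb{R}^3:x^2+y^2=r_i\}$, and a family of concentric ellipsoids $\mathcal{E}=\bigcup_i\mathcal{E}_i$ has $\mathcal{E}_i=\{(x,y,z)\in\mathbb{R}^3:x^2+\alpha y^2+\beta z^2=r_i\}$. Write $S=\bigcup_i S_i$ for either. The family $\mathcal{Y}^p$ (resp. $\mathcal{E}^p$) induced by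 $p$ is the unique one with $p(v_i)\in S_i$ for all $i$, i.e. with $r_i=x_i^2+y_i^2$ (resp. $r_i=x_i^2+\alpha y_i^2+\beta z_i^2$). A framework $(G,q)$ on $S$ is a map $q:V\to\mathbb{R}^3$ with $q(v_i)\in S_i$ for all $i$. Frameworks $(G,p),(G,q)$ on $S$ are equivalent if $\|p(v_i)-p(v_j)\|=\|q(v_i)-q(v_j)\|$ for all $v_iv_j\in E$, and congruent if this holds for all $v_i,v_j\in V$. $(G,p)$ is globally rigid on $S$ if every framework on $S$ equivalent to $(G,p)$ is congruent to $(G,p)$. Stresses. A stress is a pair $(\omega,\lambda)$ with $\omega:E\to\mathbb{R}$, $\lambda:V\to\mathbb{R}$. Put $\omega_{ij}=\omega(v_iv_j)$ if $v_iv_j\in E$ and $\omega_{ij}=0$ otherwise, and $\lambda_i=\lambda(v_i)$. It is an equilibrium stress for $(G,p)$ on $S$ if $\sum_{j=1}^n\omega_{ij}(p(v_i)-p(v_j))+\lambda_i s_i(p(v_i))=0$ for all $1\le i\le n$, where $s_i(x,y,z)=(x,y,0)$ for cylinders and $s_i(x,y,z)=(x,\alpha y,\beta z)$ for ellipsoids. Stress matrix. $\Omega$ is the $n\times n$ symmetric matrix with off-diagonal entries $-\omega_{ij}$ and diagonal entries $\sum_j\omega_{ij}$; $\Lambda=\operatorname{diag}(\lambda_1,\dots,\lambda_n)$. $\Omega_S(\omega,\lambda)$ is the $3n\times 3n$ block diagonal matrix with diagonal blocks $\Omega+\Lambda,\ \Omega+\Lambda,\ \Omega$ for cylinders, and $\Omega+\Lambda,\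 \Omega+\alpha\Lambda,\ \Omega+\beta\Lambda$ for ellipsoids.
   Formalization: For the global rigidity claim on concentric cylinders with n = 2, the graph is additionally required to have an edge: the edgeless graph on two vertices has only the zero stress, of rank 0 = 3n − 6, yet is not globally rigid. *)

(* Defs.v *)
From mathcomp Require Import all_boot all_order all_algebra.
From mathcomp Require Import reals.
From mathcomp Require Import mpoly.

Set Implicit Arguments.
Unset Strict Implicit.
Unset Printing Implicit Defensive.
Import Order.TTheory GRing.Theory Num.Theory.
Local Open Scope ring_scope.

(* The vertex set is 'I_n, and a graph is given by its edge set. A placement
   V -> R^3 is an n x 3 matrix whose i-th row is the position of vertex i. *)

Definition simple_graph (n : nat) (E : {set {set 'I_n}}) : Prop :=
  forall e, e \in E -> #|e| = 2%N.

Definition alg_independent (R : realType) (m : nat) (x : 'I_m -> R) : Prop :=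
  forall P : {mpoly rat[m]}, (map_mpoly (ratr : rat -> R) P).@[x] = 0 -> P = 0.

Definition generic (R : realType) (n : nat) (p : 'M[R]_(n, 3)) : Prop :=
  alg_independent (fun k => mxvec p 0 k).

Definition vec3 (R : realType) (x y z : R) : 'rV[R]_3 :=
  \row_k [:: x; y; z]`_k.

(* The Euclidean norm; the library norm on matrices is the sup norm. *)
Definition enorm (R : realType) (v : 'rV[R]_3) : R :=
  Num.sqrt (\sum_k v 0 k ^+ 2).

(* Which of the two kinds of families is considered; a family S of n surfaces
   is given by its kind together with r : 'I_n -> R. For the family induced by
   a generic p the r i are automatically positive. *)
Inductive surface_kind := Cylinders | Ellipsoids.

Section Surfaces.
Variables (R : realType) (alpha beta : rat) (K : surface_kind).

Definition surface_form (v : 'rV[R]_3) : R :=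
  match K with
  | Cylinders => v 0 0 ^+ 2 + v 0 1 ^+ 2
  | Ellipsoids =>
      v 0 0 ^+ 2 + ratr alpha * v 0 1 ^+ 2 + ratr beta * v 0 2 ^+ 2
  end.

Definition in_surface (r : R) (v : 'rV[R]_3) : Prop := surface_form v = r.

Definition surface_normal (v : 'rV[R]_3) : 'rV[R]_3 :=
  match K with
  | Cylinders => vec3 (v 0 0) (v 0 1) 0
  | Ellipsoids => vec3 (v 0 0) (ratr alpha * v 0 1) (ratr beta * v 0 2)
  end.

Definition mu : nat := match K with Cylinders => 6 | Ellipsoids => 3 end.

Variable n : nat.

Definition induced_family (p : 'M[R]_(n, 3)) : 'I_n -> R :=
  fun i => surface_form (row i p).

Definition framework_on (r : 'I_n -> R) (q : 'M[R]_(n, 3)) : Prop :=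
  forall i, in_surface (r i) (row i q).

Variable E : {set {set 'I_n}}.

Definition equivalent (p q : 'M[R]_(n, 3)) : Prop :=
  forall i j, [set i; j] \in E ->
    enorm (row i p - row j p) = enorm (row i q - row j q).

Definition congruent (p q : 'M[R]_(n, 3)) : Prop :=
  forall i j, enorm (row i p - row j p) = enorm (row i q - row j q).

Definition globally_rigid (r : 'I_n -> R) (p : 'M[R]_(n, 3)) : Prop :=
  forall q, framework_on r q -> equivalent p q -> congruent p q.

(* omega is a function on unordered pairs; only its values on E are used. *)
Variables (omega : {set 'I_n} -> R) (lambda : 'I_n -> R).

Definition edge_weight (i j : 'I_n) : R :=
  if [set i; j] \in E then omega [set i; j] else 0.

Definition equilibrium_stress (p : 'M[R]_(n, 3)) : Prop :=
  forall i, \sum_j edge_weight i j *: (row i p - row j p)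
            + lambda i *: surface_normal (row i p) = 0.

Definition Omega : 'M[R]_n :=
  \matrix_(i, j) if i == j then \sum_k edge_weight i k else - edge_weight i j.

Definition Lambda : 'M[R]_n := diag_mx (\row_i lambda i).

Definition block_diag3 (A B C : 'M[R]_n) : 'M[R]_(n + (n + n)) :=
  block_mx A 0 0 (block_mx B 0 0 C).

Definition stress_matrix : 'M[R]_(n + (n + n)) :=
  match K with
  | Cylinders => block_diag3 (Omega + Lambda) (Omega + Lambda) Omega
  | Ellipsoids =>
      block_diag3 (Omega + Lambda) (Omega + ratr alpha *: Lambda)
                  (Omega + ratr beta *: Lambda)
  end.

End Surfaces.

Arguments mu K : clear implicits.
Arguments surface_form {R} alpha beta K v.
Arguments in_surface {R} alpha beta K r v.
Arguments surface_normal {R} alpha beta K v.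
Arguments induced_family {R} alpha beta K {n} p.
Arguments framework_on {R} alpha beta K {n} r q.
Arguments globally_rigid {R} alpha beta K {n} E r p.
Arguments equilibrium_stress {R} alpha beta K {n} E omega lambda p.
Arguments stress_matrix {R} alpha beta K {n} E omega lambda.

(* Main.v *)
(* A stress of (G,p) on S is a vector w in the left kernel of df(p), where f is
   the polynomial map collecting the squared edge lengths and the defining
   forms of the surfaces.  For every rational polynomial F with F(f(p)) = 0,
   genericity gives F o f = 0, so dF(f(p)) lies in the left kernel of df(q)
   for every q with f(q) = f(p).  These covectors dF(f(p)) span the left
   kernel of df(p): a vector v orthogonal to all of them defines a derivation
   f_j(p) |-> v_j of Q[f(p)], which extends to Q[p], so v is in the image of
   df(p).  Hence w is also a stress of (G,q).

   Under the rank hypothesis the kernels of the blocks of the stress matrix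
   are spanned by the coordinate vectors of p (and by the constants, for the
   third block of the cylinders), so q is the image of p under a linear map
   in each group of coordinates; the surface equations at three generic
   vertices, and for cylinders one edge length, force this map to be an
   isometry up to translation. *)
From HB Require Import structures.
Require Import Defs.
From mathcomp Require Import all_boot all_order all_algebra.
From mathcomp Require Import boolp reals.
From mathcomp Require Import mpoly.
From mathcomp Require Import ring zify.
Set Implicit Arguments.
Unset Strict Implicit.
Unset Printing Implicit Defensive.
Import Order.TTheory GRing.Theory Num.Theory.
Local Open Scope ring_scope.

(** * Formal partial derivatives of multivariate polynomials and the chain rule *)

Lemma mpoly_alg_ind (A : nzRingType) (n : nat) (P : {mpoly A[n]} -> Prop) :
  (forall c, P c%:MP) -> (forall i, P 'X_i) ->
  (forall p q, P p -> P q -> P (p + q)) ->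
  (forall p q, P p -> P q -> P (p * q)) -> forall p, P p.
Proof.
move=> PC PX PD PM; elim/mpolyind => [|c m p _ _ Pp]; first exact: (PC 0).
apply: (PD _ _ _ Pp); rewrite -mul_mpolyC; apply: (PM _ _ (PC c)).
rewrite mpolyXE_id; elim/big_rec: _ => [|i q _ Pq]; first exact: (PC 1).
apply: (PM) => //; elim: (m i) => [|k IHk]; first exact: (PC 1).
by rewrite exprS; apply: PM.
Qed.

Lemma mderivXU (A : nzRingType) (n : nat) (i j : 'I_n) :
  ('X_i : {mpoly A[n]})^`M(j) = (i == j)%:R.
Proof.
rewrite mderivX mnmE; case: eqP => [->|_]; last by rewrite scale0r.
have -> : (U_(j) - U_(j) = 0 :> 'X_{1..n})%MM.
  by apply/mnmP => l; rewrite !mnmE subnn.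
by rewrite mpolyX0 scale1r.
Qed.

(** The chain rule: both sides obey the same sum and Leibniz rules in [F], which leaves only
    constants and variables to check. *)
Lemma mderiv_comp (A : comNzRingType) (n k : nat) (F : {mpoly A[n]})
    (f : n.-tuple {mpoly A[k]}) (i : 'I_k) :
  (F \mPo f)^`M(i) = \sum_j (F^`M(j) \mPo f) * (tnth f j)^`M(i).
Proof.
elim/mpoly_alg_ind: F => [c|j|p q IHp IHq|p q IHp IHq].
- rewrite comp_mpolyC mderivC big1 // => j _.
  by rewrite mderivC comp_mpoly0 mul0r.
- rewrite comp_mpolyXU -tnth_nth (bigD1 j) //= big1 => [|l /negPf ljF].
    by rewrite mderivXU eqxx comp_mpoly1 mul1r addr0.
  by rewrite mderivXU eq_sym ljF comp_mpoly0 mul0r.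
- rewrite comp_mpolyD mderivD IHp IHq -big_split; apply: eq_bigr => j _ /=.
  by rewrite mderivD comp_mpolyD mulrDl.
- rewrite rmorphM mderivM IHp IHq mulr_suml mulr_sumr -big_split.
  apply: eq_bigr => j _ /=.
  by rewrite mderivM comp_mpolyD !rmorphM /= mulrDl mulrAC mulrA.
Qed.

(** * Rational polynomials evaluated in a field, their differentials, and derivations *)

Section RationalEvaluation.
Variable F : numFieldType.

Definition qeval (n : nat) (x : 'I_n -> F) : {mpoly rat[n]} -> F :=
  meval x \o map_mpoly (ratr : rat -> F).

HB.instance Definition _ (n : nat) (x : 'I_n -> F) :=
  GRing.RMorphism.copy (qeval x) (meval x \o map_mpoly (ratr : rat -> F)).

Lemma qevalC (n : nat) (x : 'I_n -> F) (c : rat) : qeval x c%:MP = ratr c.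
Proof. by rewrite /qeval /= map_mpolyC mevalC. Qed.

Lemma qevalX (n : nat) (x : 'I_n -> F) (i : 'I_n) : qeval x 'X_i = x i.
Proof. by rewrite /qeval /= map_mpolyX mevalXU. Qed.

Lemma qeval_comp (n k : nat) (x : 'I_k -> F) (f : n.-tuple {mpoly rat[k]})
    (P : {mpoly rat[n]}) :
  qeval x (P \mPo f) = qeval (fun j => qeval x (tnth f j)) P.
Proof.
elim/mpoly_alg_ind: P => [c|j|p q IHp IHq|p q IHp IHq].
- by rewrite comp_mpolyC !qevalC.
- by rewrite comp_mpolyXU -tnth_nth qevalX.
- by rewrite comp_mpolyD !rmorphD /= IHp IHq.
- by rewrite !rmorphM /= IHp IHq.
Qed.

(** The directional derivative of [P] at [x] along [v], that is, the [eps]-part of [P] at the dual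
    numbers [x i + v i eps]. *)
Definition qdiff (n : nat) (x v : 'I_n -> F) (P : {mpoly rat[n]}) : F :=
  \sum_i qeval x P^`M(i) * v i.

Lemma qdiffD (n : nat) (x v : 'I_n -> F) : {morph qdiff x v : P Q / P + Q}.
Proof.
move=> P Q; rewrite -big_split; apply: eq_bigr => i _.
by rewrite mderivD rmorphD mulrDl.
Qed.

Lemma qdiffN (n : nat) (x v : 'I_n -> F) : {morph qdiff x v : P / - P}.
Proof.
move=> P; rewrite -sumrN; apply: eq_bigr => i _.
by rewrite mderivN rmorphN mulNr.
Qed.

Lemma qdiffM (n : nat) (x v : 'I_n -> F) (P Q : {mpoly rat[n]}) :
  qdiff x v (P * Q) = qdiff x v P * qeval x Q + qeval x P * qdiff x v Q.
Proof.
rewrite mulr_suml mulr_sumr -big_split; apply: eq_bigr => i _ /=.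
by rewrite mderivM rmorphD !rmorphM /= mulrDl mulrAC mulrA.
Qed.

Lemma qdiffC (n : nat) (x v : 'I_n -> F) (c : rat) : qdiff x v c%:MP = 0.
Proof. by apply: big1 => i _; rewrite mderivC rmorph0 mul0r. Qed.

Lemma qdiffX (n : nat) (x v : 'I_n -> F) (i : 'I_n) : qdiff x v 'X_i = v i.
Proof.
rewrite /qdiff (bigD1 i) //= big1 => [|j /negPf jiF].
  by rewrite mderivXU eqxx rmorph1 mul1r addr0.
by rewrite mderivXU eq_sym jiF rmorph0 mul0r.
Qed.

(* The graph of a derivation from a subring of F to F: a subring of the dual
   numbers over F that contains the rationals and meets 0 + F eps in 0. *)
Record derivation_graph (G : F -> F -> Prop) : Prop := DerivationGraph {
  dgC : forall c : rat, G (ratr c) 0;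
  dgB : forall a a' b b', G a a' -> G b b' -> G (a - b) (a' - b');
  dgM : forall a a' b b', G a a' -> G b b' -> G (a * b) (a' * b + a * b');
  dg_fun : forall b, G 0 b -> b = 0
}.

(** * Extension of a derivation by one element *)

Section Derivation.
Variables (G : F -> F -> Prop) (dG : derivation_graph G).

Lemma dg0 : G 0 0. Proof. by have := dgC dG 0; rewrite rmorph0. Qed.

Lemma dgD a a' b b' : G a a' -> G b b' -> G (a + b) (a' + b').
Proof.
move=> Ga Gb; have := dgB dG Ga (dgB dG dg0 Gb).
by rewrite !sub0r !opprK.
Qed.

(** The dual numbers [x i + v i eps] lie in the subring, hence so does every rational polynomial in
    them. *)
Lemma dg_mpoly (n : nat) (x v : 'I_n -> F) (P : {mpoly rat[n]}) :
  (forall i, G (x i) (v i)) -> G (qeval x P) (qdiff x v P).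
Proof.
move=> Gx; elim/mpoly_alg_ind: P => [c|i|p q IHp IHq|p q IHp IHq].
- by rewrite qevalC qdiffC; exact: dgC.
- by rewrite qevalX qdiffX.
- by rewrite rmorphD qdiffD; exact: dgD.
- by rewrite rmorphM qdiffM; exact: dgM.
Qed.

(** Makes [P + Q eps] a polynomial over the dual-number subring: [Q] carries the derivatives of the
    coefficients of [P]. *)
Definition dg_poly (P Q : {poly F}) : Prop := forall i, G P`_i Q`_i.

Lemma dg_polyB P P' Q Q' :
  dg_poly P P' -> dg_poly Q Q' -> dg_poly (P - Q) (P' - Q').
Proof. by move=> GP GQ i; rewrite !coefB; exact: dgB. Qed.

Lemma dg_polyM P P' Q Q' :
  dg_poly P P' -> dg_poly Q Q' -> dg_poly (P * Q) (P' * Q + P * Q').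
Proof.
move=> GP GQ i; rewrite coefD !coefM -big_split /=.
elim/big_rec2: _ => [|j b a _ Gab]; first exact: dg0.
by apply: dgD Gab; exact: dgM.
Qed.

Lemma dg_polyC a a' : G a a' -> dg_poly a%:P a'%:P.
Proof. by move=> Ga i; rewrite !coefC; case: eqP => // _; exact: dg0. Qed.

Lemma dg_polyX : dg_poly 'X 0.
Proof.
move=> i; rewrite coefX coef0; case: eqP => _ /=; last exact: dg0.
by have := dgC dG 1; rewrite rmorph1.
Qed.

Lemma dg_polyXn k : dg_poly 'X^k 0.
Proof.
elim: k => [|k IHk].
  by rewrite expr0; apply: dg_polyC; have := dgC dG 1; rewrite rmorph1.
by rewrite exprS; have := dg_polyM dg_polyX IHk; rewrite mul0r mulr0 addr0.
Qed.

Lemma dg_poly_deriv P P' : dg_poly P P' -> dg_poly P^`() P'^`().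
Proof.
move=> GP i; rewrite !coef_deriv; elim: {2 4}i.+1 => [|k IHk].
  by rewrite !mulr0n; exact: dg0.
by rewrite !mulrS; exact: dgD.
Qed.

(* The value d of the extended derivation at c is forced by a relation of
   minimal degree satisfied by c, and arbitrary if c is transcendental. *)
Lemma dg_value (c : F) : exists d : F, forall P P',
  dg_poly P P' -> P.[c] = 0 -> P'.[c] + P^`().[c] * d = 0.
Proof.
have zero P' : dg_poly 0 P' -> P' = 0.
  move=> G0P; apply/polyP => i; rewrite coef0; apply: (dg_fun dG).
  by have := G0P i; rewrite coef0.
(* The sizes of the nonzero polynomials over the domain of [G] that vanish at [c]. *)
pose rel k := `[< exists P P', [/\ dg_poly P P', P.[c] = 0, P != 0
                                  & size P = k] >].
have [ex_rel|no_rel] := pselect (exists k, rel k); last first.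
  exists 0 => P P' GP Pc0; rewrite mulr0 addr0.
  case: (eqVneq P 0) => [P0|Pn0].
    by rewrite P0 in GP; rewrite (zero _ GP) horner0.
  by case: no_rel; exists (size P); apply/asboolP; exists P, P'.
case: (ex_minnP ex_rel) => k /asboolP[g [g' [Gg gc0 gn0 <-]]] min_g.
have min_size P P' :
    dg_poly P P' -> P.[c] = 0 -> P != 0 -> (size g <= size P)%N.
  by move=> GP Pc0 Pn0; apply: min_g; apply/asboolP; exists P, P'.
(* In characteristic 0 the formal derivative of [g] is nonzero and smaller than [g]; its
   coefficients stay in the domain of [G], so minimality forbids that it vanishes at [c]. *)
have dgc : g^`().[c] != 0.
  apply/eqP => dgc0; have dgn0 : g^`() != 0.
    have sg : (1 < size g)%N.
      rewrite ltnNge; apply/negP => /size1_polyC gE.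
      by move: gc0 gn0; rewrite gE hornerC => ->; rewrite eqxx.
    apply/eqP => /polyP/(_ (size g).-2); rewrite coef_deriv coef0.
    have -> : (size g).-2.+1 = (size g).-1 by case: (size g) sg => [|[]].
    rewrite -/(lead_coef g) => /eqP; rewrite mulrn_eq0 lead_coef_eq0.
    by rewrite (negPf gn0) orbF; case: (size g) sg => [|[]].
  have := min_size _ _ (dg_poly_deriv Gg) dgc0 dgn0.
  by rewrite leqNgt lt_size_deriv.
have [d gd] : exists d, g'.[c] + g^`().[c] * d = 0.
  by exists (- g'.[c] / g^`().[c]); rewrite mulrC divfK // subrr.
exists d.
move=> P; have [r] := ubnP (size P); elim: r P => // r IHr P sP P' GP Pc0.
case: (eqVneq P 0) => [P0|Pn0].
  rewrite P0 in GP *; rewrite (zero _ GP).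
  by rewrite deriv0 !horner0 mul0r addr0.
have le_gP := min_size _ _ GP Pc0 Pn0.
(* Pseudo-division, since the domain of [G] is only a ring: the remainder [a P - b X^e g] is smaller
   than [P]. The derivatives [a'] and [b'] are read off at the positions of the leading
   coefficients, as [g'] and [P'] may have other sizes. *)
pose e := (size P - size g)%N; pose a := lead_coef g; pose b := lead_coef P.
pose a' := g'`_(size g).-1; pose b' := P'`_(size P).-1.
have Ga : G a a' by exact: Gg.
have Gb : G b b' by exact: GP.
have := dg_polyB (dg_polyM (dg_polyC Ga) GP)
   (dg_polyM (dg_polyM (dg_polyC Gb) (dg_polyXn e)) Gg).
rewrite mulr0 addr0; set P1 := _ - _; set Q1 := _ - _ => G1.
have P1c : P1.[c] = 0 by rewrite /P1 !hornerE Pc0 gc0 !mulr0 subrr.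
have sP1 : (size P1 < size P)%N.
  have sg0 : (0 < size g)%N by rewrite size_poly_gt0.
  have szP : (size P) = (e + size g)%N by rewrite subnK.
  have le1 : (size P1 <= size P)%N.
    rewrite /P1 -mulrA !mul_polyC (leq_trans (size_polyD _ _)) //.
    rewrite size_polyN geq_max (leq_trans (size_scale_leq _ _)) //=.
    rewrite (leq_trans (size_scale_leq _ _)) //.
    by rewrite mulrC size_mulXn // szP addnC.
  rewrite ltn_neqAle le1 andbT; apply/eqP => eqs.
  have sP0 : (0 < size P)%N by rewrite size_poly_gt0.
  have /eqP : lead_coef P1 = 0.
    rewrite /lead_coef eqs /P1 -mulrA coefB !coefCM mulrC.
    rewrite ['X^e * _]mulrC coefMXn.
    have -> : ((size P).-1 < e)%N = false.
      rewrite szP; case: (size g) sg0 => // s _.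
      by rewrite addnS ltnNge leq_addr.
    have -> : ((size P).-1 - e = (size g).-1)%N.
      by rewrite szP; case: (size g) sg0 => // s _; rewrite addnS /= addKn.
    by rewrite -/(lead_coef P) -/(lead_coef g) /a /b mulrC subrr.
  rewrite lead_coef_eq0 => /eqP P10; move: eqs sP0.
  by rewrite P10 size_poly0 => <-.
have := IHr P1 (leq_trans sP1 sP) Q1 G1 P1c.
rewrite /P1 /Q1 !derivE !hornerE Pc0 gc0 => eq1.
have an0 : a != 0 by rewrite lead_coef_eq0.
apply: (mulfI an0); rewrite mulr0 -[RHS]eq1.
(* [a] times the identity for [P], minus the one for the remainder, is a multiple of the identity
   for [g]. *)
apply/eqP; rewrite -subr_eq0; apply/eqP.
transitivity (b * c ^+ e * (g'.[c] + g^`().[c] * d)); last by rewrite gd mulr0.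
by ring.
Qed.

(** Adjoins [c + d eps] to the subring, with [d] from [dg_value]: the new elements are the values
    there of polynomials over the old subring. Property [dg_fun] is exactly what [dg_value]
    provides. *)
Lemma dg_extend (c : F) : exists G' : F -> F -> Prop,
  [/\ derivation_graph G', forall a a', G a a' -> G' a a'
    & exists d, G' c d].
Proof.
have [d Hd] := dg_value c.
exists (fun a a' => exists P P',
  [/\ dg_poly P P', a = P.[c] & a' = P'.[c] + P^`().[c] * d]).
split; last first.
- exists d, 'X, 0; split; first exact: dg_polyX.
    by rewrite hornerX.
  by rewrite derivX horner0 hornerC add0r mul1r.
- move=> a a' Ga; exists a%:P, a'%:P; split; first exact: dg_polyC.
    by rewrite hornerC.
  by rewrite derivC horner0 hornerC mul0r addr0.
split.
- move=> r; exists (ratr r)%:P, 0; split; last first.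
  + by rewrite derivC !horner0 mul0r addr0.
  + by rewrite hornerC.
  by rewrite -polyC0; apply: dg_polyC; exact: dgC.
- move=> _ _ _ _ [P [P' [GP -> ->]]] [Q [Q' [GQ -> ->]]].
  exists (P - Q), (P' - Q'); split; first exact: dg_polyB.
    by rewrite !hornerE.
  by rewrite derivB !hornerE; ring.
- move=> _ _ _ _ [P [P' [GP -> ->]]] [Q [Q' [GQ -> ->]]].
  exists (P * Q), (P' * Q + P * Q'); split; first exact: dg_polyM.
    by rewrite !hornerE.
  by rewrite derivM !hornerE; ring.
- by move=> _ [P [P' [GP /esym P0 ->]]]; exact: Hd.
Qed.

End Derivation.

Lemma dg_extend_seq (G : F -> F -> Prop) (s : seq F) :
  derivation_graph G -> exists G' : F -> F -> Prop,
  [/\ derivation_graph G', forall a a', G a a' -> G' a a'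
    & forall c, c \in s -> exists d, G' c d].
Proof.
elim: s G => [|c s IHs] G dG; first by exists G; split.
have [G1 [dG1 GG1 [d G1c]]] := dg_extend dG c.
have [G2 [dG2 G12 G2s]] := IHs _ dG1.
exists G2; split=> // [a a' /GG1/G12 //|e].
by rewrite inE => /predU1P[->|/G2s//]; exists d; exact: G12.
Qed.

(* Extend the derivation f_j(p) |-> v_j to the p_i. *)
Lemma jacobian_image (m b : nat) (f : b.-tuple {mpoly rat[m]}) (p : 'I_m -> F)
    (y := fun j => qeval p (tnth f j)) (v : 'I_b -> F) :
  (forall P : {mpoly rat[b]}, qeval y P = 0 -> qdiff y v P = 0) ->
  exists u : 'I_m -> F, forall j, v j = qdiff p u (tnth f j).
Proof.
move=> vP.
(* The assignment from [y j] to [v j], extended to all rational polynomials in [y]; the hypothesis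
   on [v] makes it well defined. *)
pose G a a' := exists P : {mpoly rat[b]}, a = qeval y P /\ a' = qdiff y v P.
have dG : derivation_graph G.
  split.
  - by move=> c; exists c%:MP; rewrite qevalC qdiffC.
  - move=> _ _ _ _ [P [-> ->]] [Q [-> ->]]; exists (P - Q).
    by rewrite rmorphB qdiffD qdiffN.
  - move=> _ _ _ _ [P [-> ->]] [Q [-> ->]]; exists (P * Q).
    by rewrite rmorphM qdiffM.
  - by move=> _ [P [/esym/vP P0 ->]].
have [G' [dG' GG' Gp]] := dg_extend_seq [seq p i | i <- enum 'I_m] dG.
have /choice[u Gu] : forall i, exists d, G' (p i) d.
  by move=> i; apply: Gp; apply: map_f; rewrite mem_enum.
(* Both [v j] and the differential along [u] are values of the extended derivation at the same
   element [y j]. *)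
exists u => j; apply/eqP; rewrite -subr_eq0; apply/eqP; apply: (dg_fun dG').
rewrite -(subrr (y j)); apply: (dgB dG'); last exact: dg_mpoly.
by apply: GG'; exists 'X_j; rewrite qevalX qdiffX.
Qed.

(** Adding a row outside the current span raises the rank, which is at most [b]. The rows stay in
    [S], so that for gradients of relations each row still comes from one relation. *)
Lemma row_span_of_set (b : nat) (S : 'rV[F]_b -> Prop) :
  exists k (M : 'M[F]_(k, b)),
    (forall i, S (row i M)) /\ (forall u, S u -> (u <= M)%MS).
Proof.
have: exists k (M : 'M[F]_(k, b)), forall i, S (row i M).
  by exists 0%N, 0; case.
case=> k [M]; have [r] := ubnP (b - \rank M)%N.
elim: r k M => // r IHr k M rM SM.
have [?|/existsNP[u /not_implyP[Su uM]]] :=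
  pselect (forall u, S u -> (u <= M)%MS); first by exists k, M.
apply: (IHr _ (col_mx M u)); last first.
  move=> i; case: (split_ordP i) => j ->; rewrite (rowKu, rowKd) //.
  by rewrite row_id.
have ltM : (\rank M < \rank (col_mx M u))%N.
  rewrite ltn_neqAle andbC mxrankS /=; last first.
    by rewrite -addsmxE addsmxSl.
  apply/eqP => eqr; apply: uM.
  have /eqmxP/eqmx_sym/eqmxP/andP[+ _] : (M == col_mx M u)%MS.
    by rewrite -(geq_leqif (mxrank_leqif_eq _)) ?eqr // -addsmxE addsmxSl.
  by apply: submx_trans; rewrite -addsmxE addsmxSr.
move: rM (rank_leq_col (col_mx M u)) ltM; rewrite !ltnS.
by move=> + le1 lt1; apply: leq_trans; rewrite ltn_sub2l // (leq_trans lt1).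
Qed.

End RationalEvaluation.


(** * Transfer of left kernel vectors of the Jacobian from a generic point *)

(** The composite of [P] with [f] vanishes at the independent point [p], hence identically; its
    derivative at [q] is expanded by the chain rule. *)
Lemma relation_jacobian (R : realType) (m b : nat)
    (f : b.-tuple {mpoly rat[m]}) (p q : 'I_m -> R) (P : {mpoly rat[b]})
    (u : 'I_m -> R) :
  alg_independent p -> (forall j, qeval p (tnth f j) = qeval q (tnth f j)) ->
  qeval (fun j => qeval p (tnth f j)) P = 0 ->
  qdiff (fun j => qeval p (tnth f j)) (fun j => qdiff q u (tnth f j)) P = 0.
Proof.
move=> indep_p /funext fpq; rewrite -qeval_comp => /indep_p Pf0; rewrite fpq.
transitivity (qdiff q u (P \mPo f)); last first.
  by rewrite Pf0; apply: big1 => i _; rewrite mderiv0 rmorph0 mul0r.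
under [LHS]eq_bigr do rewrite mulr_sumr.
rewrite exchange_big; apply: eq_bigr => i _ /=.
rewrite mderiv_comp rmorph_sum mulr_suml; apply: eq_bigr => j _ /=.
by rewrite rmorphM /= qeval_comp mulrA.
Qed.

Lemma stress_transfer (R : realType) (m b : nat)
    (f : b.-tuple {mpoly rat[m]}) (p q : 'I_m -> R) (w : 'I_b -> R) :
  alg_independent p -> (forall j, qeval p (tnth f j) = qeval q (tnth f j)) ->
  (forall u, \sum_j w j * qdiff p u (tnth f j) = 0) ->
  forall u, \sum_j w j * qdiff q u (tnth f j) = 0.
Proof.
move=> indep_p fpq wp u; pose y j := qeval p (tnth f j).
pose grad P := \row_j qeval y (P^`M(j)).
have [k [M [SM subM]]] := row_span_of_set
  (fun g : 'rV[R]_b => exists P, qeval y P = 0 /\ g = grad P).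
have gradE P (v : 'cV[R]_b) : (grad P *m v) 0 0 = qdiff y (v^~ 0) P.
  by rewrite mxE; apply: eq_bigr => j _; rewrite mxE.
(* Every gradient kills each column of the cokernel of [M], so by [jacobian_image] that column is a
   value of the differential of [f] at [p], where [w] vanishes. *)
have : ((\row_j w j) <= M)%MS.
  rewrite submxE; apply/eqP/rowP => l; rewrite mxE [RHS]mxE.
  have [|v vE] := @jacobian_image R m b f p (fun j => cokermx M j l).
    move=> P P0; have /subM : exists Q, qeval y Q = 0 /\ grad P = grad Q.
      by exists P.
    rewrite submxE => /eqP/rowP/(_ l); rewrite mxE [RHS]mxE => gP0.
    by rewrite -[RHS]gP0 /qdiff; apply: eq_bigr => j _; rewrite [in RHS]mxE.
  rewrite -[RHS](wp v); by apply: eq_bigr => j _; rewrite mxE vE.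
case/submxP => D wE.
pose v : 'cV[R]_b := \col_j qdiff q u (tnth f j).
(* Each row of [M] is the gradient of a relation, to which [relation_jacobian] applies. *)
have Mv0 : M *m v = 0.
  apply/matrixP => i j; rewrite ord1 [RHS]mxE.
  have [P [P0 rowP]] := SM i.
  have -> : (M *m v) i 0 = (row i M *m v) 0 0 by rewrite -row_mul [RHS]mxE.
  rewrite rowP gradE -[RHS](relation_jacobian u indep_p fpq P0).
  by apply: eq_bigr => l _; rewrite mxE.
have /matrixP/(_ 0 0) : (\row_j w j) *m v = 0.
  by rewrite wE -mulmxA Mv0 mulmx0.
rewrite mxE [RHS]mxE => w0; rewrite -[RHS]w0.
by apply: eq_bigr => j _; rewrite !mxE.
Qed.

Lemma stress_transfer_fin (R : realType) (m : nat) (T : finType)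
    (f : T -> {mpoly rat[m]}) (p q : 'I_m -> R) (w : T -> R) :
  alg_independent p -> (forall t, qeval p (f t) = qeval q (f t)) ->
  (forall u, \sum_t w t * qdiff p u (f t) = 0) ->
  forall u, \sum_t w t * qdiff q u (f t) = 0.
Proof.
move=> indep_p fpq wp.
have sumE x u : \sum_t w t * qdiff x u (f t) =
  \sum_(j < #|T|) w (enum_val j) *
     qdiff x u (tnth [tuple f (enum_val i) | i < #|T|] j).
  rewrite (reindex_onto enum_val enum_rank) /=; last first.
    by move=> t _; rewrite enum_rankK.
  apply: eq_big => [j|j _]; first by rewrite enum_valK eqxx.
  by rewrite tnth_mktuple.
move=> u; rewrite sumE; apply: (stress_transfer indep_p) => [j|v].
  by rewrite tnth_mktuple.
by rewrite -sumE.
Qed.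

Lemma enorm_eq (R : realType) (v w : 'rV[R]_3) :
  enorm v = enorm w <-> \sum_k v 0 k ^+ 2 = \sum_k w 0 k ^+ 2.
Proof.
have pos (x : 'rV[R]_3) : 0 <= \sum_k x 0 k ^+ 2.
  by apply: sumr_ge0 => k _; exact: sqr_ge0.
split=> [/eqP|eqvw]; last by rewrite /enorm eqvw.
by rewrite /enorm eqr_sqrt // => /eqP.
Qed.

Lemma enorm_row_sub (R : realType) (n : nat) (p q : 'M[R]_(n, 3)) i j :
  enorm (row i p - row j p) = enorm (row i q - row j q) <->
  \sum_c (p i c - p j c) ^+ 2 = \sum_c (q i c - q j c) ^+ 2.
Proof.
have rowE (x : 'M[R]_(n, 3)) :
    \sum_c (row i x - row j x) 0 c ^+ 2 = \sum_c (x i c - x j c) ^+ 2.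
  by apply: eq_bigr => c _; rewrite !mxE.
by rewrite -!rowE; exact: enorm_eq.
Qed.

(** * Edge lengths and surface equations as rational polynomials; virtual work *)

Section Constraints.
Variables (R : realType) (alpha beta : rat) (K : surface_kind) (n : nat).
Variable E : {set {set 'I_n}}.

Definition coord_poly (i : 'I_n) (c : 'I_3) : {mpoly rat[n * 3]} :=
  'X_(mxvec_index i c).

Definition dist_poly (i j : 'I_n) : {mpoly rat[n * 3]} :=
  \sum_c (coord_poly i c - coord_poly j c) * (coord_poly i c - coord_poly j c).

(** The surface form is diagonal for both kinds; these coefficients also give the normal and the
    multiples of [Lambda] in the stress matrix. *)
Definition surface_coef (c : 'I_3) : rat :=
  match K with
  | Cylinders => [:: 1; 1; 0]`_c
  | Ellipsoids => [:: 1; alpha; beta]`_c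
  end.

Definition surface_poly (i : 'I_n) : {mpoly rat[n * 3]} :=
  \sum_c (surface_coef c)%:MP * (coord_poly i c * coord_poly i c).

(** Indexing by ordered pairs gives a plain finite type: each edge between distinct vertices occurs
    twice, and non-edges carry the zero polynomial. *)
Definition constraint (t : 'I_n * 'I_n + 'I_n) : {mpoly rat[n * 3]} :=
  match t with
  | inl (i, j) => if [set i; j] \in E then dist_poly i j else 0
  | inr i => surface_poly i
  end.

Definition point (x : 'M[R]_(n, 3)) (k : 'I_(n * 3)) : R := mxvec x 0 k.

Lemma qeval_coord x i c : qeval (point x) (coord_poly i c) = x i c.
Proof. by rewrite qevalX /point mxvecE. Qed.

Lemma qdiff_coord x v i c : qdiff (point x) (point v) (coord_poly i c) = v i c.
Proof. by rewrite qdiffX /point mxvecE. Qed.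

Lemma qdiff_sum m (x v : 'I_m -> R) (I : finType) (P : I -> {mpoly rat[m]}) :
  qdiff x v (\sum_i P i) = \sum_i qdiff x v (P i).
Proof.
apply: (big_morph (qdiff x v) (qdiffD x v)).
by apply: big1 => i _; rewrite mderiv0 rmorph0 mul0r.
Qed.

Lemma qeval_dist x i j :
  qeval (point x) (dist_poly i j) = \sum_c (x i c - x j c) ^+ 2.
Proof.
rewrite rmorph_sum; apply: eq_bigr => c _.
by rewrite rmorphM !rmorphB /= !qeval_coord expr2.
Qed.

Lemma qdiff_dist x v i j : qdiff (point x) (point v) (dist_poly i j) =
  2 * \sum_c (x i c - x j c) * (v i c - v j c).
Proof.
rewrite qdiff_sum mulr_sumr; apply: eq_bigr => c _.
rewrite qdiffM qdiffD qdiffN !rmorphB /= !qeval_coord !qdiff_coord.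
by ring.
Qed.

Lemma surface_formE (v : 'rV[R]_3) :
  surface_form alpha beta K v = \sum_c ratr (surface_coef c) * v 0 c ^+ 2.
Proof.
rewrite !big_ord_recl big_ord0 /surface_form /surface_coef.
have -> : lift ord0 ord0 = 1 :> 'I_3 by apply: val_inj.
have -> : lift ord0 (lift ord0 ord0) = 2 :> 'I_3 by apply: val_inj.
by case: K => /=; rewrite ?rmorph1 ?rmorph0; ring.
Qed.

Lemma surface_normalE (v : 'rV[R]_3) c :
  surface_normal alpha beta K v 0 c = ratr (surface_coef c) * v 0 c.
Proof.
rewrite /surface_normal /surface_coef /vec3.
case: c => [[|[|[|//]]] lt_c]; case: K => /=; rewrite mxE /= ?rmorph1 ?rmorph0;
  rewrite ?mul0r ?mul1r //; try congr (_ * _); congr (v 0 _); exact: val_inj.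
Qed.

Lemma qeval_surface x i :
  qeval (point x) (surface_poly i) = surface_form alpha beta K (row i x).
Proof.
rewrite surface_formE rmorph_sum; apply: eq_bigr => c _.
by rewrite !rmorphM /= qevalC !qeval_coord mxE expr2.
Qed.

Lemma qdiff_surface x v i : qdiff (point x) (point v) (surface_poly i) =
  2 * \sum_c surface_normal alpha beta K (row i x) 0 c * v i c.
Proof.
rewrite qdiff_sum mulr_sumr; apply: eq_bigr => c _.
rewrite surface_normalE mxE.
by rewrite !qdiffM qdiffC rmorphM /= qevalC !qeval_coord !qdiff_coord; ring.
Qed.

Variables (omega : {set 'I_n} -> R) (lambda : 'I_n -> R).

Lemma edge_weightC i j : edge_weight E omega i j = edge_weight E omega j i.
Proof. by rewrite /edge_weight setUC. Qed.

Definition net_force (x : 'M[R]_(n, 3)) (i : 'I_n) : 'rV[R]_3 :=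
  \sum_j edge_weight E omega i j *: (row i x - row j x)
  + lambda i *: surface_normal alpha beta K (row i x).

(** The factor 2 on [lambda] compensates for edges being counted in both orders. *)
Definition multiplier (t : 'I_n * 'I_n + 'I_n) : R :=
  match t with
  | inl (i, j) => edge_weight E omega i j
  | inr i => 2 * lambda i
  end.

(** Summation by parts. In the factor 4, one 2 comes from differentiating squares, the other from
    the double count of edges and from the 2 in [multiplier]. *)
Lemma virtual_work x v :
  \sum_t multiplier t * qdiff (point x) (point v) (constraint t) =
  4 * \sum_i \sum_c net_force x i 0 c * v i c.
Proof.
rewrite big_sumType /=.
have -> : \sum_i 2 * lambda i * qdiff (point x) (point v) (surface_poly i) =
  4 * \sum_i \sum_c
    lambda i * surface_normal alpha beta K (row i x) 0 c * v i c.
  rewrite mulr_sumr; apply: eq_bigr => i _; rewrite qdiff_surface !mulr_sumr.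
  by apply: eq_bigr => c _; ring.
have -> : \sum_(ij : 'I_n * 'I_n) multiplier (inl ij) *
    qdiff (point x) (point v) (constraint (inl ij)) =
  2 * \sum_i \sum_j edge_weight E omega i j *
    \sum_c (x i c - x j c) * (v i c - v j c).
  rewrite pair_bigA mulr_sumr; apply: eq_bigr => -[i j] _ /=.
  rewrite /edge_weight; case: ifP => _; last by rewrite !mul0r mulr0.
  by rewrite qdiff_dist mulrCA.
pose W i j c := edge_weight E omega i j * (x i c - x j c).
have -> : \sum_i \sum_j edge_weight E omega i j *
    (\sum_c (x i c - x j c) * (v i c - v j c)) =
  2 * \sum_i \sum_c (\sum_j W i j c) * v i c.
  have -> : \sum_i \sum_c (\sum_j W i j c) * v i c =
      \sum_i \sum_j \sum_c W i j c * v i c.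
    apply: eq_bigr => i _; rewrite exchange_big; apply: eq_bigr => c _.
    by rewrite mulr_suml.
  (* One of the two copies has its indices exchanged; symmetry of the weights then turns [v i c]
     into [- v j c]. *)
  rewrite (mulr_natl _ 2) mulr2n [X in _ = _ + X]exchange_big -big_split.
  apply: eq_bigr => i _; rewrite -big_split; apply: eq_bigr => j _ /=.
  rewrite -big_split mulr_sumr; apply: eq_bigr => c _.
  by rewrite /W (edge_weightC j i) /=; ring.
rewrite mulrA -natrM -mulrDr -big_split; congr (_ * _).
apply: eq_bigr => i _; rewrite -big_split; apply: eq_bigr => c _ /=.
rewrite -mulrDl; congr (_ * _).
rewrite /net_force [RHS]mxE summxE [X in _ = _ + X]mxE; congr (_ + _).
by apply: eq_bigr => j _; rewrite !mxE.
Qed.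

(** Identifies stresses with left kernel vectors of the Jacobian; the converse tests displacements
    of one coordinate of one vertex. *)
Lemma equilibrium_virtual_work x :
  equilibrium_stress alpha beta K E omega lambda x <->
  forall u, \sum_t multiplier t * qdiff (point x) u (constraint t) = 0.
Proof.
split=> [eq_x u|work0 i].
  have -> : u = point (vec_mx (\row_k u k)).
    by apply/funext => k; rewrite /point vec_mxK mxE.
  rewrite virtual_work big1 ?mulr0 // => i _; apply: big1 => c _.
  by rewrite [net_force x i]eq_x mxE mul0r.
apply/rowP => c; have := work0 (point (delta_mx i c)); rewrite virtual_work.
move/eqP; rewrite mulf_eq0 pnatr_eq0 /= => /eqP.
rewrite (bigD1 i) //= [X in _ + X]big1 => [|i' /negPf i'F]; last first.
  by apply: big1 => c' _; rewrite [delta_mx _ _ _ _]mxE i'F mulr0.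
rewrite (bigD1 c) //= big1 => [|c' /negPf c'F]; last first.
  by rewrite [delta_mx _ _ _ _]mxE c'F andbF mulr0.
by rewrite [delta_mx _ _ _ _]mxE !eqxx mulr1 !addr0 => fc0; rewrite [RHS]mxE.
Qed.

Lemma equilibrium_stress_equivalent (p q : 'M[R]_(n, 3)) : generic p ->
  equilibrium_stress alpha beta K E omega lambda p ->
  framework_on alpha beta K (induced_family alpha beta K p) q ->
  equivalent E p q ->
  equilibrium_stress alpha beta K E omega lambda q.
Proof.
move=> gen_p /equilibrium_virtual_work work_p on_q pq.
apply/equilibrium_virtual_work; apply: (stress_transfer_fin gen_p) => //.
case=> [[i j]|i] /=; last by rewrite !qeval_surface; apply: esym (on_q i).
case: ifP => [ijE|_]; last by rewrite !rmorph0.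
by rewrite !qeval_dist; apply/enorm_row_sub; exact: pq.
Qed.

End Constraints.

Arguments coord_poly : simpl never.


Lemma ord2_ind (P : 'I_2 -> Prop) : P 0 -> P 1 -> forall a, P a.
Proof.
move=> P0 P1 [[|[|//]] lt_a].
- by rewrite (_ : Ordinal _ = 0) //; apply: val_inj.
- by rewrite (_ : Ordinal _ = 1) //; apply: val_inj.
Qed.

Lemma ord3_ind (P : 'I_3 -> Prop) : P 0 -> P 1 -> P 2 -> forall a, P a.
Proof.
move=> P0 P1 P2 [[|[|[|//]]] lt_a].
- by rewrite (_ : Ordinal _ = 0) //; apply: val_inj.
- by rewrite (_ : Ordinal _ = 1) //; apply: val_inj.
- by rewrite (_ : Ordinal _ = 2) //; apply: val_inj.
Qed.

Lemma sum_ord2 (V : nmodType) (F : 'I_2 -> V) : \sum_c F c = F 0 + F 1.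
Proof.
rewrite !big_ord_recl big_ord0 addr0.
by congr (_ + F _); apply: val_inj.
Qed.

Lemma sum_ord3 (V : nmodType) (F : 'I_3 -> V) : \sum_c F c = F 0 + F 1 + F 2.
Proof.
rewrite !big_ord_recl big_ord0 addr0 addrA.
by congr (_ + F _ + F _); apply: val_inj.
Qed.

(** * Linear independence, determinants and kernels *)

Section LinearIndependence.
Variable F : fieldType.

(** Independence of the rows of a square array, so that one determinant decides it. *)
Definition lin_indep (k : nat) (A : 'I_k -> 'I_k -> F) : Prop :=
  forall v : 'I_k -> F,
    (forall b, \sum_a v a * A a b = 0) -> forall a, v a = 0.

Lemma lin_indep_det (k : nat) (A : 'M[F]_k) :
  lin_indep (fun a b => A a b) <-> \det A != 0.
Proof.
rewrite -unitfE -[_ \is a _]unitmxE -row_free_unit; split=> [indepA|freeA v vA].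
  apply: inj_row_free => v vA; apply/rowP => a; rewrite [RHS]mxE.
  apply: (indepA (v 0)) => b; have /rowP/(_ b) := vA.
  by rewrite mxE [RHS]mxE.
have : (\row_a v a) *m A = 0.
  by apply/rowP => b; rewrite mxE [RHS]mxE -[RHS](vA b);
     apply: eq_bigr => a _; rewrite mxE.
move/eqP; rewrite mulmx_free_eq0 // => /eqP/rowP v0 a.
by have := v0 a; rewrite !mxE.
Qed.

(** The columns picked by [g] certify that the [k] vectors are independent. They lie in the left
    kernel, of dimension [n - \rank A], and span it when that dimension is [k]. *)
Lemma kernel_span (k n : nat) (X : 'I_k -> 'I_n -> F) (g : 'I_k -> 'I_n)
    (A : 'M[F]_n) :
  lin_indep (fun a b => X a (g b)) ->
  (forall a, (\row_i X a i) *m A = 0) ->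
  (\rank A + k <= n)%N /\
  ((\rank A + k)%N = n -> forall y : 'I_n -> F, (\row_i y i) *m A = 0 ->
     exists d, forall i, y i = \sum_a d a * X a i).
Proof.
move=> indepX XA; pose M : 'M[F]_(k, n) := \matrix_(a, i) X a i.
have freeM : row_free M.
  apply: inj_row_free => v vM; apply/rowP => a; rewrite [RHS]mxE.
  apply: (indepX (v 0)) => b; have /rowP/(_ (g b)) := vM.
  rewrite mxE [RHS]mxE => vM0; rewrite -[RHS]vM0.
  by apply: eq_bigr => c _; rewrite mxE.
have MA : (M <= kermx A)%MS.
  apply/sub_kermxP/row_matrixP => a; rewrite row_mul row0.
  by rewrite -[RHS](XA a); congr (_ *m _); apply/rowP => i; rewrite !mxE.
have le_k : (k <= n - \rank A)%N.
  by rewrite -mxrank_ker -(eqP freeM); exact: mxrankS.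
have leA := rank_leq_row A.
split=> [|rankA y yA]; first by lia.
have kerM : (kermx A <= M)%MS.
  rewrite -(geq_leqif (mxrank_leqif_sup MA)) mxrank_ker (eqP freeM).
  by lia.
have /submx_trans/(_ kerM) : ((\row_i y i) <= kermx A)%MS by exact/sub_kermxP.
case/submxP => D yE; exists (D 0) => i.
have /rowP/(_ i) := yE; rewrite mxE => ->; rewrite mxE.
by apply: eq_bigr => a _; rewrite mxE.
Qed.

End LinearIndependence.

(** The determinant is a rational polynomial; if it is nonzero at one convenient point [x], it is
    not the zero polynomial and cannot vanish at [p]. *)
Lemma generic_lin_indep (R : realType) (k m : nat)
    (N : 'I_k -> 'I_k -> {mpoly rat[m]}) (p x : 'I_m -> R) :
  alg_independent p ->
  lin_indep (fun a b => qeval x (N a b)) ->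
  lin_indep (fun a b => qeval p (N a b)).
Proof.
move=> indep_p indep_x; pose M := \matrix_(a, b) N a b.
have detE y : lin_indep (fun a b => qeval y (N a b)) <-> qeval y (\det M) != 0.
  rewrite -det_map_mx -lin_indep_det.
  by split=> indep v vN; apply: indep => b; rewrite -[RHS](vN b);
     apply: eq_bigr => a _; rewrite !mxE.
apply/detE; move/detE: indep_x; apply: contraNneq => /indep_p ->.
by rewrite rmorph0.
Qed.

(** * Nondegeneracy of generic placements, each checked at a special placement *)

Section GenericPlacement.
Variables (R : realType) (n : nat) (p : 'M[R]_(n, 3)).
Hypothesis gen_p : generic p.

Lemma generic_coord_neq0 i c : p i c != 0.
Proof.
apply/eqP => p0.
have : lin_indep (fun _ _ : 'I_1 => qeval (point p) (coord_poly i c)).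
  apply: (@generic_lin_indep _ _ _ _ _ (point (const_mx 1))) => // v v0 a.
  have := v0 a; rewrite qeval_coord mxE big_ord1 mulr1.
  by rewrite (ord1 a).
move=> indep; suff /eqP : 1 = 0 :> R by rewrite oner_eq0.
by apply: (indep (fun=> 1) _ 0) => b; rewrite qeval_coord p0 big_ord1 mulr0.
Qed.

Lemma generic_xy_indep (g : 'I_2 -> 'I_n) : injective g ->
  lin_indep (fun a b => p (g b) (if a == 0 then 0 else 1)).
Proof.
move=> inj_g.
(* Puts [g 0] at (1,0,0) and [g 1] at (0,1,0), so the array becomes the identity. *)
pose x : 'M[R]_(n, 3) := \matrix_(i, c)
  ((i == g 0) && (c == 0) || (i == g 1) && (c == 1))%:R.
have indep : lin_indep (fun a b : 'I_2 =>
    qeval (point p) (coord_poly (g b) (if a == 0 then 0 else 1))).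
  apply: (@generic_lin_indep _ _ _ _ _ (point x)) => // v v0.
  apply: ord2_ind; [have := v0 0 | have := v0 1];
    rewrite sum_ord2 /= !qeval_coord !mxE !(inj_eq inj_g) /=.
  - by rewrite mulr1 mulr0 addr0.
  - by rewrite mulr1 mulr0 add0r.
move=> v v0; apply: indep => b; rewrite -[RHS](v0 b).
by apply: eq_bigr => a _; rewrite qeval_coord.
Qed.

Lemma generic_1z_indep (g : 'I_2 -> 'I_n) : injective g ->
  lin_indep (fun a b => if a == 0 then 1 else p (g b) 2).
Proof.
(* Height 0 at [g 0] and 1 at [g 1] make the array triangular. *)
move=> inj_g; pose x : 'M[R]_(n, 3) := \matrix_(i, c) (i == g 1)%:R.
have indep : lin_indep (fun a b : 'I_2 =>
    qeval (point p) (if a == 0 then 1 else coord_poly (g b) 2)).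
  apply: (@generic_lin_indep _ _ _ _ _ (point x)) => // v v0.
  have v00 : v 0 = 0.
    have := v0 0; rewrite sum_ord2 /= qeval_coord mxE (inj_eq inj_g) /=.
    by rewrite rmorph1 mulr1 mulr0 addr0.
  apply: (ord2_ind v00).
  have := v0 1; rewrite sum_ord2 /= qeval_coord mxE eqxx v00.
  by rewrite mul0r mulr1 add0r.
move=> v v0; apply: indep => b; rewrite -[RHS](v0 b).
by apply: eq_bigr => a _; case: ifP; rewrite ?rmorph1 ?qeval_coord.
Qed.

Lemma generic_z_inj i j : i != j -> p i 2 != p j 2.
Proof.
move=> neq_ij; apply/eqP => eq_z.
pose g (a : 'I_2) := if a == 0 then i else j.
have inj_g : injective g.
  by apply: ord2_ind; apply: ord2_ind; rewrite /g //= => /eqP;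
     rewrite ?(negPf neq_ij) // eq_sym (negPf neq_ij).
suff /eqP : -1 = 0 :> R by rewrite oppr_eq0 oner_eq0.
(* With equal heights z, the combination z * 1 + (-1) * z vanishes at both vertices. *)
pose v (a : 'I_2) := if a == 0 then p i 2 else -1.
apply: (generic_1z_indep inj_g (v := v) _ 1).
by apply: ord2_ind; rewrite sum_ord2 /v /= /g /= -?eq_z; ring.
Qed.

Lemma generic_squares (g : 'I_3 -> 'I_n) (v : 'I_3 -> R) : injective g ->
  (forall i, \sum_c v c * p i c ^+ 2 = 0) -> forall c, v c = 0.
Proof.
move=> inj_g v0; pose x : 'M[R]_(n, 3) := \matrix_(i, c) (i == g c)%:R.
have indep : lin_indep (fun a b : 'I_3 =>
    qeval (point p) (coord_poly (g b) a ^+ 2)).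
  apply: (@generic_lin_indep _ _ _ _ _ (point x)) => // w w0 a.
  rewrite -[RHS](w0 a) (bigD1 a) //= big1 => [|b /negPf baF].
    by rewrite rmorphXn /= qeval_coord mxE eqxx expr1n mulr1 addr0.
  by rewrite rmorphXn /= qeval_coord mxE (inj_eq inj_g) eq_sym baF expr0n mulr0.
apply: indep => b; rewrite -[RHS](v0 (g b)).
by apply: eq_bigr => a _; rewrite rmorphXn /= qeval_coord.
Qed.

Lemma generic_binary_form (g : 'I_3 -> 'I_n) (a b c : R) : injective g ->
  (forall i, a * p i 0 ^+ 2 + b * p i 1 ^+ 2 + c * (p i 0 * p i 1) = 0) ->
  [/\ a = 0, b = 0 & c = 0].
Proof.
move=> inj_g abc0.
(* In the first two coordinates the vertices go to (1,0), (0,1) and (1,1), which isolate [a], then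
   [b], then [c]. *)
pose x : 'M[R]_(n, 3) := \matrix_(i, c) ((i == g c) || (i == g 2))%:R.
pose N (l r : 'I_3) : {mpoly rat[n * 3]} :=
  [:: coord_poly (g r) 0 ^+ 2; coord_poly (g r) 1 ^+ 2;
      coord_poly (g r) 0 * coord_poly (g r) 1]`_l.
have indep : lin_indep (fun l r => qeval (point p) (N l r)).
  apply: (@generic_lin_indep _ _ _ _ _ (point x)) => // w w0.
  have wE r : w 0 * x (g r) 0 ^+ 2 + w 1 * x (g r) 1 ^+ 2
              + w 2 * (x (g r) 0 * x (g r) 1) = 0.
    by have := w0 r; rewrite sum_ord3 /= !rmorphXn rmorphM /= !qeval_coord.
  have w00 : w 0 = 0.
    by have := wE 0; rewrite !mxE !(inj_eq inj_g) /= => <-; ring.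
  have w10 : w 1 = 0.
    by have := wE 1; rewrite !mxE !(inj_eq inj_g) /= => <-; ring.
  apply: (ord3_ind w00 w10).
  by have := wE 2; rewrite !mxE !(inj_eq inj_g) /= w00 w10 => <-; ring.
have v0 : forall l : 'I_3, [:: a; b; c]`_l = 0.
  apply: indep => r; rewrite sum_ord3 /= !rmorphXn rmorphM /= !qeval_coord.
  exact: abc0.
by split; [exact: (v0 0) | exact: (v0 1) | exact: (v0 2)].
Qed.

End GenericPlacement.

(** * Blocks of the stress matrix and the equilibrium equations *)

Section StressMatrix.
Variables (R : realType) (alpha beta : rat) (K : surface_kind) (n : nat).
Variables (E : {set {set 'I_n}}) (hE : simple_graph E).
Variables (omega : {set 'I_n} -> R) (lambda : 'I_n -> R).

Definition stress_block (s : rat) : 'M[R]_n :=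
  Omega E omega + ratr s *: Lambda lambda.

Notation block c := (stress_block (surface_coef alpha beta K c)).

Lemma rank_stress_matrix :
  \rank (stress_matrix alpha beta K E omega lambda) =
  (\rank (block 0%R) + \rank (block 1%R) + \rank (block 2%R))%N.
Proof.
rewrite /stress_matrix /block_diag3.
rewrite /stress_block /surface_coef; case: K => /=;
  rewrite !rank_diag_block_mx !rmorph1 ?rmorph0 ?scale1r ?scale0r ?addr0;
  by rewrite addnA.
Qed.

Lemma edge_weightii i : edge_weight E omega i i = 0.
Proof.
rewrite /edge_weight; case: ifP => // /hE.
by rewrite setUid cards1.
Qed.

Lemma stress_blockE (s : rat) (y : 'I_n -> R) i :
  ((\row_k y k) *m stress_block s) 0 i =
  \sum_j edge_weight E omega i j * (y i - y j) + ratr s * lambda i * y i.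
Proof.
rewrite mulmxDr mxE; congr (_ + _); last first.
  by rewrite -scalemxAr mxE mul_mx_diag !mxE mulrA mulrAC.
rewrite mxE (bigD1 i) //= !mxE eqxx.
under eq_bigr => k /negPf ki do rewrite !mxE ki mulrN edge_weightC mulrC.
rewrite sumrN; under [RHS]eq_bigr do rewrite mulrBr.
rewrite sumrB -mulr_suml [y i * _]mulrC; congr (_ - _).
by rewrite [RHS](bigD1 i) //= edge_weightii mul0r add0r.
Qed.

(** The normal is diagonal in the coordinates, so the equilibrium equations separate into one linear
    system per coordinate. *)
Lemma equilibrium_block (x : 'M[R]_(n, 3)) (c : 'I_3) :
  equilibrium_stress alpha beta K E omega lambda x ->
  (\row_i x i c) *m block c = 0.
Proof.
move=> eq_x; apply/rowP => i; rewrite stress_blockE [RHS]mxE.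
have /rowP/(_ c) := eq_x i; rewrite mxE [RHS]mxE summxE => fi0.
rewrite -[RHS]fi0; congr (_ + _).
  by apply: eq_bigr => j _; rewrite !mxE.
by rewrite [RHS]mxE surface_normalE mxE mulrCA mulrA.
Qed.

Lemma stress_block_const : (\row__ 1) *m stress_block 0 = 0 :> 'rV[R]_n.
Proof.
apply/rowP => i; rewrite (stress_blockE 0 (fun=> 1)) rmorph0 !mul0r addr0 mxE.
by apply: big1 => j _; rewrite subrr mulr0.
Qed.

(** Without edges the first coordinate of equilibrium reads [lambda i * p i 0 = 0], and [p i 0] is
    nonzero by genericity. *)
Lemma edgeless_stress_block (p : 'M[R]_(n, 3)) (s : rat) :
  generic p -> equilibrium_stress alpha beta K E omega lambda p ->
  E = set0 -> stress_block s = 0.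
Proof.
move=> gen_p eq_p E0.
have w0 i j : edge_weight E omega i j = 0 by rewrite /edge_weight E0 inE.
have lambda0 i : lambda i = 0.
  have := equilibrium_block 0 eq_p => /rowP/(_ i).
  rewrite stress_blockE [RHS]mxE big1 => [|j _]; last by rewrite w0 mul0r.
  have -> : surface_coef alpha beta K 0 = 1 by rewrite /surface_coef; case: K.
  rewrite rmorph1 add0r mul1r => /eqP; rewrite mulf_eq0.
  by rewrite (negPf (generic_coord_neq0 gen_p i 0)) orbF => /eqP.
apply/row_matrixP => i; rewrite row0 rowE.
have -> : delta_mx 0 i = \row_k (k == i)%:R :> 'rV[R]_n.
  by apply/rowP => k; rewrite !mxE eqxx.
apply/rowP => j; rewrite stress_blockE lambda0 mulr0 mul0r addr0 [RHS]mxE.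
by apply: big1 => k _; rewrite w0 mul0r.
Qed.

End StressMatrix.

(** On two vertices any edge is the whole vertex set, so the only distance is prescribed. *)
Lemma congruent_two_vertices (R : realType) (n : nat) (E : {set {set 'I_n}})
    (p q : 'M[R]_(n, 3)) :
  simple_graph E -> (n <= 2)%N -> (n = 2%N -> E != set0) ->
  equivalent E p q -> congruent p q.
Proof.
move=> hE le_n2 E_n0 pq i j; have [->|neq_ij] := eqVneq i j.
  by rewrite !subrr.
have card_ij : #|[set i; j]| = 2%N by rewrite cards2 neq_ij.
have n2 : n = 2%N.
  by have := max_card [set i; j]; rewrite card_ij card_ord; lia.
apply: pq; have /set0Pn[e eE] := E_n0 n2.
have fullT (A : {set 'I_n}) : #|A| = 2%N -> A = setT.
  by move=> cA; apply/eqP; rewrite eqEcard subsetT cardsT card_ord cA n2.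
by rewrite (fullT _ card_ij) -(fullT e (hE e eE)).
Qed.

(** * Congruence from maximal rank on at least three vertices *)

Section LargeRank.
Variables (R : realType) (alpha beta : rat) (n : nat) (E : {set {set 'I_n}}).
Variables (omega : {set 'I_n} -> R) (lambda : 'I_n -> R) (p q : 'M[R]_(n, 3)).
Hypotheses (hE : simple_graph E) (gen_p : generic p) (n3 : (3 <= n)%N).
Hypothesis pq : equivalent E p q.

Lemma ellipsoid_congruent : alpha != 0 -> beta != 0 ->
  equilibrium_stress alpha beta Ellipsoids E omega lambda p ->
  equilibrium_stress alpha beta Ellipsoids E omega lambda q ->
  framework_on alpha beta Ellipsoids
    (induced_family alpha beta Ellipsoids p) q ->
  (\rank (stress_matrix alpha beta Ellipsoids E omega lambda) + 3 = 3 * n)%N ->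
  congruent p q.
Proof.
move=> alpha0 beta0 eq_p eq_q on_q.
pose coef := surface_coef alpha beta Ellipsoids.
rewrite rank_stress_matrix => rank_eq.
have n0 : (0 < n)%N by lia.
pose i0 := Ordinal n0.
have indep c : lin_indep (fun _ _ : 'I_1 => p i0 c).
  move=> v v0 a; have := v0 a; rewrite big_ord1 (ord1 a) => /eqP.
  by rewrite mulf_eq0 (negPf (generic_coord_neq0 gen_p i0 c)) orbF => /eqP.
have ker c := kernel_span (X := fun _ i => p i c) (g := fun=> i0) (indep c)
  (fun=> equilibrium_block hE c eq_p).
(* Each block has rank at most [n - 1], so the total [3 * n - 3] forces equality in all three. *)
have rank_c : forall c,
    (\rank (stress_block E omega lambda (coef c)) + 1)%N = n.
  have [r0 _] := ker 0; have [r1 _] := ker 1; have [r2 _] := ker 2.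
  by apply: ord3_ind; rewrite /coef; lia.
have scale c : exists d, forall i, q i c = d * p i c.
  have [_ /(_ (rank_c c) (fun i => q i c))] := ker c.
  case=> [|d qE]; first exact: equilibrium_block.
  by exists (d 0) => i; rewrite qE big_ord1.
have [d qE] := choice scale.
pose g := widen_ord n3.
have inj_g : injective g by move=> a b /(congr1 val) /= /val_inj.
have d1 c : d c ^+ 2 = 1.
  have coef0 : ratr (coef c) != 0 :> R.
    by rewrite fmorph_eq0; move: c; apply: ord3_ind; rewrite /= ?oner_eq0.
  apply/eqP; rewrite -subr_eq0 -(mulrI_eq0 _ (mulfI coef0)); apply/eqP.
  (* The coefficients of the difference of the surface equations of [q] and [p], a diagonal form in
     the coordinates of [p]. *)
  pose v c : R := ratr (coef c) * (d c ^+ 2 - 1).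
  apply: (generic_squares gen_p (v := v) inj_g) => i.
  have := on_q i; rewrite /in_surface /induced_family !surface_formE => /eqP.
  rewrite -subr_eq0 -sumrB => /eqP sum0; rewrite -[RHS]sum0.
  by apply: eq_bigr => l _; rewrite /v !mxE qE; ring.
move=> i j; apply/enorm_row_sub/eq_bigr => c _.
by rewrite !qE -mulrBr exprMn d1 mul1r.
Qed.

Lemma cylinder_congruent : E != set0 ->
  equilibrium_stress alpha beta Cylinders E omega lambda p ->
  equilibrium_stress alpha beta Cylinders E omega lambda q ->
  framework_on alpha beta Cylinders (induced_family alpha beta Cylinders p) q ->
  (\rank (stress_matrix alpha beta Cylinders E omega lambda) + 6 = 3 * n)%N ->
  congruent p q.
Proof.
move=> /set0Pn[e eE] eq_p eq_q on_q.
pose r s : nat := \rank (stress_block E omega lambda s).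
rewrite rank_stress_matrix.
rewrite -[(\rank _ + _ + _)%N]/(r 1%R + r 1%R + r 0%R)%N => rank_eq.
have n2 : (2 <= n)%N by lia.
pose g2 := widen_ord n2; pose g3 := widen_ord n3.
have inj_g2 : injective g2 by move=> a b /(congr1 val) /= /val_inj.
have inj_g3 : injective g3 by move=> a b /(congr1 val) /= /val_inj.
have [rank_xy ker_xy] := kernel_span (A := stress_block E omega lambda 1)
  (X := fun (a : 'I_2) i => p i (if a == 0 then 0 else 1))
  (generic_xy_indep gen_p inj_g2)
  (ord2_ind (equilibrium_block hE 0 eq_p) (equilibrium_block hE 1 eq_p)).
have [rank_z ker_z] := kernel_span (A := stress_block E omega lambda 0)
  (X := fun (a : 'I_2) i => if a == 0 then 1 else p i 2)
  (generic_1z_indep gen_p inj_g2)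
  (ord2_ind (stress_block_const hE omega lambda) (equilibrium_block hE 2 eq_p)).
rewrite -/(r _) in rank_xy ker_xy; rewrite -/(r _) in rank_z ker_z.
(* All three blocks have rank at most [n - 2], and the ranks add up to [3 * n - 6]. *)
have [rank_xy_eq rank_z_eq] : (r 1%R + 2 = n)%N /\ (r 0%R + 2 = n)%N by lia.
have {}ker_xy := ker_xy rank_xy_eq; have {}ker_z := ker_z rank_z_eq.
have [d qx] := ker_xy (fun i => q i 0) (equilibrium_block hE 0 eq_q).
have [f qy] := ker_xy (fun i => q i 1) (equilibrium_block hE 1 eq_q).
have [h qz] := ker_z (fun i => q i 2) (equilibrium_block hE 2 eq_q).
have {}qx i : q i 0 = d 0 * p i 0 + d 1 * p i 1 by rewrite qx sum_ord2.
have {}qy i : q i 1 = f 0 * p i 0 + f 1 * p i 1 by rewrite qy sum_ord2.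
have {}qz i : q i 2 = h 0 + h 1 * p i 2 by rewrite qz sum_ord2 /= mulr1.
(* The three coefficients vanish exactly when the planar matrix with rows [d] and [f] is
   orthogonal. *)
have [d1 f1 df] := generic_binary_form gen_p
  (a := d 0 ^+ 2 + f 0 ^+ 2 - 1) (b := d 1 ^+ 2 + f 1 ^+ 2 - 1)
  (c := 2 * (d 0 * d 1 + f 0 * f 1)) inj_g3
  ltac:(move=> i; have := on_q i;
    rewrite /in_surface /induced_family /= !mxE qx qy => on_qi;
    apply/eqP; rewrite -[X in _ == X](subrr (p i 0 ^+ 2 + p i 1 ^+ 2));
    rewrite -{1}on_qi; apply/eqP; ring).
have xyE i j : (q i 0 - q j 0) ^+ 2 + (q i 1 - q j 1) ^+ 2 =
    (p i 0 - p j 0) ^+ 2 + (p i 1 - p j 1) ^+ 2.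
  rewrite !qx !qy; apply/eqP; rewrite -subr_eq0; apply/eqP.
  transitivity ((d 0 ^+ 2 + f 0 ^+ 2 - 1) * (p i 0 - p j 0) ^+ 2
    + (d 1 ^+ 2 + f 1 ^+ 2 - 1) * (p i 1 - p j 1) ^+ 2
    + 2 * (d 0 * d 1 + f 0 * f 1) * ((p i 0 - p j 0) * (p i 1 - p j 1))).
    by ring.
  by rewrite d1 f1 df !mul0r !addr0.
(* The cylinders do not constrain heights; along one edge the planar parts cancel by [xyE], and the
   height difference is nonzero by genericity. *)
have h1 : h 1 ^+ 2 = 1.
  have /eqP/cards2P[i [j [neq_ij eE']]] := hE eE; rewrite eE' in eE.
  have /enorm_row_sub := pq eE; rewrite 2!sum_ord3 xyE => /addrI.
  rewrite !qz => z_eq.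
  have zn0 : (p i 2 - p j 2) ^+ 2 != 0.
    by rewrite expf_neq0 // subr_eq0 generic_z_inj.
  by apply: (mulIf zn0); rewrite mul1r [RHS]z_eq; ring.
move=> i j; apply/enorm_row_sub; rewrite 2!sum_ord3 xyE; congr (_ + _).
transitivity (h 1 ^+ 2 * (p i 2 - p j 2) ^+ 2); first by rewrite h1 mul1r.
by rewrite !qz; ring.
Qed.

End LargeRank.

Theorem theorem5p2 (R : realType) (alpha beta : rat)
    (h1alpha : 1 < alpha) (hbeta : alpha < beta)
    (n : nat) (E : {set {set 'I_n}}) (hE : simple_graph E)
    (p : 'M[R]_(n, 3)) (hp : generic p)
    (K : surface_kind)
    (omega : {set 'I_n} -> R) (lambda : 'I_n -> R)
    (hstress : equilibrium_stress alpha beta K E omega lambda p) :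
  (forall q : 'M[R]_(n, 3),
     framework_on alpha beta K (induced_family alpha beta K p) q ->
     equivalent E p q ->
     equilibrium_stress alpha beta K E omega lambda q)
  /\
  ((* without this premise the edgeless graph on two vertices is a
      counterexample for cylinders *)
   (K = Cylinders -> n = 2%N -> E != set0) ->
   (\rank (stress_matrix alpha beta K E omega lambda) + mu K = 3 * n)%N ->
   globally_rigid alpha beta K E (induced_family alpha beta K p) p).
Proof.
split=> [q|E_cyl rank_eq q on_q pq].
  exact: equilibrium_stress_equivalent hp hstress.
have eq_q := equilibrium_stress_equivalent hp hstress on_q pq.
(* An edgeless graph has zero stress matrix, so the rank condition leaves only [n = 2] for cylinders
   and [n = 1] for ellipsoids. *)
have edges : E = set0 -> (3 * n = mu K)%N.
  move=> E0; rewrite -rank_eq rank_stress_matrix.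
  by rewrite !(edgeless_stress_block hE _ hp hstress E0) mxrank0.
(* The quadratic form arguments need three distinct vertices, so smaller graphs are treated
   directly. *)
have [le_n2|n3] := leqP n 2.
  apply: (congruent_two_vertices hE le_n2 _ pq) => n2; case eqK: K.
    exact: E_cyl.
  by apply/eqP => /edges; rewrite eqK n2.
have alpha_gt0 : 0 < alpha by apply: lt_trans h1alpha.
have beta_gt0 : 0 < beta by apply: lt_trans hbeta.
case: K hstress on_q eq_q rank_eq edges {E_cyl} => eq_p on_q eq_q rank_eq edges.
  have E_n0 : E != set0 by apply/eqP => /edges /=; lia.
  exact: (cylinder_congruent hE hp n3 pq E_n0 eq_p eq_q on_q rank_eq).
by apply: (ellipsoid_congruent hE hp n3 _ _ eq_p eq_q on_q rank_eq);
   exact: lt0r_neq0.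
Qed.
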